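(* Let $\xi_0$ be an $\mathbf{R}^Z$-valued random vector with support $\mathbf{\Xi}\subset\mathbf{R}^Z$, and let $A:\mathbf{\Xi}\to\mathbf{R}^{n\times n}$, $B:\mathbf{\Xi}\to\mathbf{R}^{n\times p_w}$, $C:\mathbf{\Xi}\to\mathbf{R}^{q_z\times n}$, $D:\mathbf{\Xi}\to\mathbf{R}^{q_z\times p_w}$ be Borel functions such that the squares of all entries of $A(\xi_0),B(\xi_0),C(\xi_0),D(\xi_0)$ are Lebesgue integrable (have finite expectation). Let $\bar A\in\mathbf{R}^{\bar n\times n^2}$ ($\bar n\le n^2$) be a matrix satisfying $$\bar A^T\bar A=E\big[\mathrm{row}(A(\xi_0))^T\,\mathrm{row}(A(\xi_0))\big],$$ partition it as $\bar A=[\bar A_1,\ldots,\bar A_n]$ with $\bar A_i\in\mathbf{R}^{\bar n\times n}$ ($i=1,\ldots,n$), and set $\widetilde A:=[\bar A_1^T,\ldots,\bar A_n^T]^T\in\mathbf{R}^{n\bar n\times n}$. For given $\gamma>0$ and given (symmetric) positive definite $P\in\mathbf{R}^{n\times n}$, the following two conditions are equivalent. 1. The following two inequalities hold: $$E[P-A(\xi_0)^TPA(\xi_0)-C(\xi_0)^TC(\xi_0)]>0,$$ $$E[\mathrm{tr}(D(\xi_0)^TD(\xi_0)+B(\xi_0)^TPB(\xi_0))]<\gamma^2.$$ 2. The following two inequalities hold: $$P-\widetilde A^T(P\otimes I_{\bar n})\widetilde A-E[C(\xi_0)^TC(\xi_0)]>0,$$ $$\mathrm{tr}\left(E[D(\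xi_0)^TD(\xi_0)]\right)+\mathrm{tr}\left(E[B(\xi_0)B(\xi_0)^T]P\right)<\gamma^2.$$
   Context: For symmetric matrices, $>0$ means positive definite; $\otimes$ is the Kronecker product and $I_m$ the $m\times m$ identity. For a matrix $M$ with $m$ rows, $\mathrm{row}(M):=[\mathrm{row}_1(M),\ldots,\mathrm{row}_m(M)]$ is the row vector obtained by concatenating the rows $\mathrm{row}_i(M)$ of $M$ in order. The expectation of a random matrix is taken entrywise. *)

(* Defs.v *)
From mathcomp Require Import all_boot all_order all_algebra.
From mathcomp Require Import mxtens.
From mathcomp Require Import all_classical all_reals all_analysis.

Set Implicit Arguments.
Unset Strict Implicit.
Unset Printing Implicit Defensive.

Import Order.TTheory GRing.Theory Num.Theory.
Import numFieldNormedType.Exports.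

Local Open Scope classical_set_scope.
Local Open Scope ring_scope.

(* 'M[R]_(m, k) with its Borel sigma-algebra; R^Z is borelmx R 1 Z. *)
Notation borelmx R m k := (g_sigma_algebraType (@open 'M[R]_(m, k))).

Definition rv_support (R : realType) (d : measure_display)
    (Omega : measurableType d) (mu : probability Omega R) (Z : nat)
    (xi : {RV mu >-> borelmx R 1 Z}) : set 'rV[R]_Z :=
  [set x | forall U : set 'rV[R]_Z,
     open U -> U x -> (0 < distribution mu xi U)%E].

(* F is a Borel function on Xi; its values outside Xi are irrelevant. *)
Definition borel_fun_on (R : realType) (Z m k : nat) (Xi : set 'rV[R]_Z)
    (F : 'rV[R]_Z -> 'M[R]_(m, k)) : Prop :=
  @measurable_fun _ _ (borelmx R 1 Z) (borelmx R m k) Xi F.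

(* The random matrix F(xi), for F of which only the values on Xi matter.  The
   points sent by xi outside its support Xi form a null event, on which F(xi)
   is given the value 0. *)
Definition comp_rv (R : realType) (Omega : Type) (Z m k : nat)
    (Xi : set 'rV[R]_Z) (xi : Omega -> 'rV[R]_Z)
    (F : 'rV[R]_Z -> 'M[R]_(m, k)) (w : Omega) : 'M[R]_(m, k) :=
  if xi w \in Xi then F (xi w) else 0.

Definition square_integrable_mx (R : realType) (d : measure_display)
    (Omega : measurableType d) (mu : probability Omega R) (m k : nat)
    (M : Omega -> 'M[R]_(m, k)) : Prop :=
  forall i j, mu.-integrable setT (fun w => ((M w i j) ^+ 2)%:E).

Definition expectation_mx (R : realType) (d : measure_display)
    (Omega : measurableType d) (mu : probability Omega R) (m k : nat)
    (M : Omega -> 'M[R]_(m, k)) : 'M[R]_(m, k) :=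
  \matrix_(i, j) fine 'E_mu[fun w => M w i j].

Definition posdefmx (R : realType) (n : nat) (M : 'M[R]_n) : Prop :=
  M^T = M /\ forall x : 'cV[R]_n, x != 0 -> 0 < (x^T *m M *m x) 0 0.

Lemma index_allpairs (T1 T2 : eqType) (s : seq T1) (t : seq T2) x y :
  x \in s -> y \in t ->
  index (x, y) [seq (a, b) | a <- s, b <- t] = (index x s * size t + index y t)%N.
Proof.
move=> + yt; elim: s => //= a s IH; rewrite inE index_cat => xas.
have [->|nxa] := eqVneq a x.
  rewrite map_f // index_map //; by move=> ? ? [].
rewrite eq_sym (negPf nxa) /= in xas.
rewrite ifN; first by rewrite IH // size_map mulSn addnA.
by apply/mapP => -[b _ [xa _]]; rewrite xa eqxx in nxa.
Qed.

(* mxvec M is the concatenation of the rows of M: entry (i, j) of an m x k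
   matrix is at position i * k + j, as for the indices of A *t B. *)
Lemma mxvec_index_row_major (m k : nat) (i : 'I_m) (j : 'I_k) :
  mxvec_index i j = mxtens_index (i, j).
Proof.
apply: val_inj => /=.
rewrite /enum_rank [enum_rank_in]unlock /= insubdK; last first.
  by rewrite -topredE /= cardE index_mem mem_enum.
rewrite enumT unlock /= /prod_enum index_allpairs ?mem_enum //.
by rewrite !index_enum_ord size_enum_ord.
Qed.

(* The block Abar_i of Abar = [Abar_1, ..., Abar_n]. *)
Definition col_block (R : realType) (n nbar : nat)
    (Abar : 'M[R]_(nbar, n * n)) (i : 'I_n) : 'M[R]_(nbar, n) :=
  colsub (fun j => mxtens_index (i, j)) Abar.

(* Row i * nbar + k of [Abar_1^T, ..., Abar_n^T]^T is row k of Abar_i. *)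
Definition stack_blocks (R : realType) (n nbar : nat)
    (Abar : 'M[R]_(nbar, n * n)) : 'M[R]_(n * nbar, n) :=
  \matrix_(r, j) col_block Abar (mxtens_unindex r).1 (mxtens_unindex r).2 j.

(* Main.v *)
(* The entries of A(xi0), B(xi0), C(xi0), D(xi0) are square integrable, so all
   products of two entries are integrable and the expectation commutes with
   linear maps of row(A)^T row(A), B B^T, C^T C and D^T D.  Each entry of
   A^T P A is a linear function of row(A)^T row(A), and the same function takes
   Abar^T Abar to the corresponding entry of At^T (P (x) I) At; by cyclicity of
   the trace, tr(B^T P B) = tr(B B^T P).  Hence the two sides of each pair of
   inequalities are equal. *)
Require Import Defs.
From HB Require Import structures.
From mathcomp Require Import all_boot all_order all_algebra.
From mathcomp Require Import mxtens.
From mathcomp Require Import all_classical all_reals all_analysis.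
From mathcomp Require Import measurable_realfun lra.

Set Implicit Arguments.
Unset Strict Implicit.

Import Order.TTheory GRing.Theory Num.Theory.
Import numFieldNormedType.Exports.

Local Open Scope classical_set_scope.
Local Open Scope ring_scope.

Lemma open_measurable_borelmx (R : realType) (m k : nat) (U : set 'M[R]_(m, k)) :
  open U -> measurable (U : set (borelmx R m k)).
Proof. exact: sub_sigma_algebra. Qed.

(** Coordinate maps are continuous, and open intervals generate the Borel sets of [R]. *)
Lemma measurable_entry (R : realType) (m k : nat) (i : 'I_m) (j : 'I_k) :
  measurable_fun setT (fun M : borelmx R m k => (M : 'M[R]_(m, k)) i j).
Proof.
apply: (measurability _ (measurable_realfun.RGenOpens.measurableE R)) => _ [_ [x [y ->]] <-].
rewrite setTI; apply: open_measurable_borelmx.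
by move/continuousP: (@coord_continuous R m k i j); apply; exact: interval_open.
Qed.

Section Moments.
Context (R : realType) (d : measure_display) (Omega : measurableType d).
Context (mu : probability Omega R).

(** The support is closed: an open set [U] of probability zero around a point outside it shows that
    every other point of [U] is outside as well. *)
Lemma measurable_rv_support (Z : nat) (xi : {RV mu >-> borelmx R 1 Z}) :
  measurable (rv_support xi : set (borelmx R 1 Z)).
Proof.
rewrite -[rv_support xi]setCK; apply: measurableC; apply: open_measurable_borelmx.
rewrite openE => x /existsNP[U /not_implyP[oU /not_implyP[Ux U0]]].
rewrite /interior nbhsE /=; exists U; first by split.
by move=> y Uy /(_ U oU Uy).
Qed.

(** As [comp_rv] is 0 off the support, it is [xi] followed by the extension of [F] by zero, which is
    measurable because the support is. *)
Lemma measurable_comp_rv (Z m k : nat) (xi : {RV mu >-> borelmx R 1 Z})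
    (F : 'rV[R]_Z -> 'M[R]_(m, k)) i j :
  borel_fun_on (rv_support xi) F ->
  measurable_fun setT (fun w => comp_rv (rv_support xi) xi F w i j).
Proof.
move=> mF; set S := rv_support xi; have mS := measurable_rv_support xi.
have -> : (fun w => comp_rv S xi F w i j) = ((fun x => F x i j) \_ S) \o xi.
  by apply/funext => w; rewrite /comp_rv /patch /=; case: ifP; rewrite ?mxE.
apply: (@measurableT_comp _ _ _ _ (borelmx R 1 Z)) => //.
apply/(measurable_restrictT _ mS).
apply: (@measurable_comp _ _ _ (borelmx R 1 Z) (borelmx R m k) _ setT
  (fun M => M i j) S F) => //; exact: measurable_entry.
Qed.

Definition integrable_mx (m k : nat) (M : Omega -> 'M[R]_(m, k)) : Prop :=
  forall i j, mu.-integrable setT (fun w => (M w i j)%:E).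

Definition measurable_mx (m k : nat) (M : Omega -> 'M[R]_(m, k)) : Prop :=
  forall i j, measurable_fun setT (fun w => M w i j).

(** The product is dominated by [f ^+ 2 + g ^+ 2], since the square of [|f| - |g|] is
    nonnegative. *)
Lemma integrable_mul_sqr (f g : Omega -> R) :
  measurable_fun setT f -> measurable_fun setT g ->
  mu.-integrable setT (fun w => (f w ^+ 2)%:E) ->
  mu.-integrable setT (fun w => (g w ^+ 2)%:E) ->
  mu.-integrable setT (fun w => (f w * g w)%:E).
Proof.
move=> mf mg f2 g2; apply: (le_integrable _ _ _ (integrableD _ f2 g2)) => //.
  by apply/measurable_EFinP; exact: measurable_funM.
move=> w _; rewrite -EFinD !abse_EFin lee_fin normrM.
rewrite [leRHS]ger0_norm ?addr_ge0 ?sqr_ge0//.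
rewrite -[f w ^+ 2]real_normK ?num_real// -[g w ^+ 2]real_normK ?num_real//.
by have := sqr_ge0 (`|f w| - `|g w|); have := normr_ge0 (f w); have := normr_ge0 (g w); nra.
Qed.

Lemma integrable_mulmx (m k p : nat)
    (M : Omega -> 'M[R]_(m, k)) (N : Omega -> 'M[R]_(k, p)) :
  measurable_mx M -> measurable_mx N ->
  square_integrable_mx mu M -> square_integrable_mx mu N ->
  integrable_mx (fun w => M w *m N w).
Proof.
move=> mM mN iM iN i j.
under eq_fun do rewrite mxE -sumEFin.
by apply: integrable_sum => // l _; exact: integrable_mul_sqr.
Qed.

Lemma measurable_mx_tr (m k : nat) (M : Omega -> 'M[R]_(m, k)) :
  measurable_mx M -> measurable_mx (fun w => (M w)^T).
Proof. by move=> mM i j; under eq_fun do rewrite mxE; exact: mM. Qed.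

Lemma square_integrable_mx_tr (m k : nat) (M : Omega -> 'M[R]_(m, k)) :
  square_integrable_mx mu M -> square_integrable_mx mu (fun w => (M w)^T).
Proof. by move=> iM i j; under eq_fun do rewrite mxE; exact: iM. Qed.

Lemma integrable_gram (m k : nat) (M : Omega -> 'M[R]_(m, k)) :
  measurable_mx M -> square_integrable_mx mu M ->
  integrable_mx (fun w => (M w)^T *m M w).
Proof.
move=> mM iM; apply: integrable_mulmx => //; first exact: measurable_mx_tr.
exact: square_integrable_mx_tr.
Qed.

(** Expansion in matrix units reduces a linear functional to a finite combination of entries. *)
Lemma scalar_sum_delta (m k : nat) (f : {scalar 'M[R]_(m, k)}) (M : 'M[R]_(m, k)) :
  f M = \sum_i \sum_j f (delta_mx i j) * M i j.
Proof.
rewrite {1}[M]matrix_sum_delta linear_sum; apply: eq_bigr => i _.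
by rewrite linear_sum; apply: eq_bigr => j _; rewrite linearZ /= mulrC.
Qed.

Lemma integrable_scalar (m k : nat) (f : {scalar 'M[R]_(m, k)})
    (M : Omega -> 'M[R]_(m, k)) :
  integrable_mx M -> mu.-integrable setT (fun w => (f (M w))%:E).
Proof.
move=> iM; under eq_fun do rewrite scalar_sum_delta -sumEFin.
apply: integrable_sum => // i _; under eq_fun do rewrite -sumEFin.
apply: integrable_sum => // j _; under eq_fun do rewrite EFinM.
exact: integrableZl.
Qed.

(** The integral passes through a finite sum of integrable entries. Being stated in the extended
    reals, the equality also says that the expectation is finite. *)
Lemma expectation_scalar (m k : nat) (f : {scalar 'M[R]_(m, k)})
    (M : Omega -> 'M[R]_(m, k)) :
  integrable_mx M -> ('E_mu[fun w => f (M w)] = (f (expectation_mx mu M))%:E)%E.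
Proof.
move=> iM; rewrite unlock scalar_sum_delta -sumEFin.
under eq_integral do rewrite scalar_sum_delta -sumEFin.
have ifM i j : mu.-integrable setT (fun w => (f (delta_mx i j) * M w i j)%:E).
  by under eq_fun do rewrite EFinM; exact: integrableZl.
rewrite integral_sum//; last first.
  by move=> i; under eq_fun do rewrite -sumEFin; apply: integrable_sum.
apply: eq_bigr => i _; under eq_integral do rewrite -sumEFin.
rewrite integral_sum// -sumEFin; apply: eq_bigr => j _.
under eq_integral do rewrite EFinM.
(* [expectation_mx] applies [fine], which is harmless here: an integrable entry has a finite
   integral. *)
by rewrite integralZl// mxE unlock EFinM fineK// integrable_fin_num.
Qed.

Lemma expectation_mxB (m k : nat) (M N : Omega -> 'M[R]_(m, k)) :
  integrable_mx M -> integrable_mx N ->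
  expectation_mx mu (fun w => M w - N w) = expectation_mx mu M - expectation_mx mu N.
Proof.
move=> iM iN; apply/matrixP => i j; rewrite !mxE unlock.
rewrite -[RHS]RintegralB//; [|exact: iM|exact: iN].
by congr fine; apply: eq_integral => w _; rewrite !mxE.
Qed.

Lemma integrable_mxB (m k : nat) (M N : Omega -> 'M[R]_(m, k)) :
  integrable_mx M -> integrable_mx N -> integrable_mx (fun w => M w - N w).
Proof.
move=> iM iN i j; under eq_fun do rewrite !mxE EFinB.
exact: integrableB.
Qed.

Lemma integrable_mx_cst (m k : nat) (M : 'M[R]_(m, k)) : integrable_mx (fun=> M).
Proof. by move=> i j; exact: finite_measure_integrable_cst. Qed.

Lemma expectation_mx_cst (m k : nat) (M : 'M[R]_(m, k)) :
  expectation_mx mu (fun=> M) = M.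
Proof. by apply/matrixP => i j; rewrite mxE expectation_cst. Qed.

End Moments.

(* The linear function of [G] that gives entry (i, j) of [X^T P Y] when
   [G = row(X)^T row(Y)]. *)
Definition sandwich (R : realType) (n : nat) (P : 'M[R]_n) (i j : 'I_n)
    (G : 'M[R]_(n * n)) : R :=
  \sum_k \sum_l P k l * G (mxtens_index (k, i)) (mxtens_index (l, j)).

Lemma sandwich_scalar (R : realType) (n : nat) (P : 'M[R]_n) i j :
  scalar (sandwich P i j).
Proof.
move=> a G H; rewrite /sandwich mulr_sumr -big_split; apply: eq_bigr => k _ /=.
rewrite mulr_sumr -big_split; apply: eq_bigr => l _ /=.
by rewrite !mxE mulrDr mulrCA.
Qed.

(** This lets [expectation_scalar] and [integrable_scalar] apply to [sandwich P i j]. *)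
HB.instance Definition _ (R : realType) (n : nat) (P : 'M[R]_n) i j :=
  GRing.isLinear.Build R 'M[R]_(n * n) R *%R (sandwich P i j) (sandwich_scalar P i j).

(** [mxvec] is row-major, so the entry of the outer product at [(k, i)], [(l, j)] is
    [A k i * A l j]. *)
Lemma sandwich_row (R : realType) (n : nat) (P A : 'M[R]_n) i j :
  sandwich P i j ((mxvec A)^T *m mxvec A) = (A^T *m P *m A) i j.
Proof.
rewrite -mulmxA mxE; apply: eq_bigr => k _; rewrite !mxE mulr_sumr.
apply: eq_bigr => l _; rewrite !mxE big_ord1 !mxE -!mxvec_index_row_major.
by rewrite !mxvecE mulrCA.
Qed.

Lemma stack_blocksE (R : realType) (n nbar : nat) (Abar : 'M[R]_(nbar, n * n)) k q j :
  stack_blocks Abar (mxtens_index (k, q)) j = Abar q (mxtens_index (k, j)).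
Proof. by rewrite mxE mxtens_indexK mxE. Qed.

(** The rows of [stack_blocks Abar] are indexed by pairs [(k, q)]. The factor [1%:M] couples
    [(k, q)] only to the pairs [(l, q)], with weight [P k l], and summing over [q] produces the
    entries of the Gram matrix of [Abar]. *)
Lemma sandwich_gram (R : realType) (n nbar : nat) (P : 'M[R]_n)
    (Abar : 'M[R]_(nbar, n * n)) i j :
  sandwich P i j (Abar^T *m Abar) =
  ((stack_blocks Abar)^T *m (P *t (1%:M : 'M[R]_nbar)) *m stack_blocks Abar) i j.
Proof.
rewrite -mulmxA mxE.
have reindex_tens (F : 'I_(n * nbar) -> R) :
    \sum_r F r = \sum_k \sum_q F (mxtens_index (k, q)).
  rewrite pair_big; apply: reindex.
  exists (@mxtens_unindex n nbar) => [[k q]|r] _; first exact: mxtens_indexK.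
  exact: mxtens_unindexK.
rewrite reindex_tens; apply: eq_bigr => k _.
under eq_bigr => l _ do rewrite mxE mulr_sumr.
rewrite exchange_big; apply: eq_bigr => q _ /=.
rewrite [in RHS]mxE stack_blocksE [in RHS]mxE reindex_tens mulr_sumr; apply: eq_bigr => l _.
(* Off-diagonal terms [q' != q] vanish through the identity factor. *)
rewrite (bigD1 q)//= big1 ?addr0.
  by rewrite tensmxE stack_blocksE ?mxE eqxx mulr1 mulrCA.
by move=> q' q'q; rewrite tensmxE !mxE eq_sym (negPf q'q) mulr0 mul0r.
Qed.

Unset Implicit Arguments.
Set Strict Implicit.

Theorem theorem4 (R : realType) (d : measure_display)
    (Omega : measurableType d) (mu : probability Omega R)
    (Z n pw qz nbar : nat)
    (xi0 : {RV mu >-> borelmx R 1 Z}) (Xi : set 'rV[R]_Z)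
    (hXi : Xi = rv_support xi0)
    (A : 'rV[R]_Z -> 'M[R]_n) (B : 'rV[R]_Z -> 'M[R]_(n, pw))
    (C : 'rV[R]_Z -> 'M[R]_(qz, n)) (D : 'rV[R]_Z -> 'M[R]_(qz, pw))
    (mA : borel_fun_on Xi A)
    (mB : borel_fun_on Xi B)
    (mC : borel_fun_on Xi C)
    (mD : borel_fun_on Xi D)
    (iA : square_integrable_mx mu (comp_rv Xi xi0 A))
    (iB : square_integrable_mx mu (comp_rv Xi xi0 B))
    (iC : square_integrable_mx mu (comp_rv Xi xi0 C))
    (iD : square_integrable_mx mu (comp_rv Xi xi0 D))
    (Abar : 'M[R]_(nbar, n * n)) (hnbar : (nbar <= n ^ 2)%N)
    (hAbar : Abar^T *m Abar =
       expectation_mx mu (fun w => (mxvec (comp_rv Xi xi0 A w))^T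
                                     *m mxvec (comp_rv Xi xi0 A w)))
    (gamma : R) (hgamma : 0 < gamma) (P : 'M[R]_n) (hP : posdefmx P) :
  let A0 := comp_rv Xi xi0 A in
  let B0 := comp_rv Xi xi0 B in
  let C0 := comp_rv Xi xi0 C in
  let D0 := comp_rv Xi xi0 D in
  let At := stack_blocks Abar in
  (posdefmx (expectation_mx mu
       (fun w => P - (A0 w)^T *m P *m A0 w - (C0 w)^T *m C0 w)) /\
   ('E_mu[fun w => \tr ((D0 w)^T *m D0 w + (B0 w)^T *m P *m B0 w)]
      < (gamma ^+ 2)%:E)%E)
  <->
  (posdefmx (P - At^T *m (P *t (1%:M : 'M[R]_nbar)) *m At
               - expectation_mx mu (fun w => (C0 w)^T *m C0 w)) /\
   \tr (expectation_mx mu (fun w => (D0 w)^T *m D0 w))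
     + \tr (expectation_mx mu (fun w => B0 w *m (B0 w)^T) *m P) < gamma ^+ 2).
Proof.
move=> A0 B0 C0 D0 At; subst Xi.
have m0 k l (F : 'rV_Z -> 'M[R]_(k, l)) : borel_fun_on (rv_support xi0) F ->
    measurable_mx (comp_rv (rv_support xi0) xi0 F).
  by move=> mF i j; exact: measurable_comp_rv.
have iCC : integrable_mx mu (fun w => (C0 w)^T *m C0 w).
  exact: integrable_gram (m0 _ _ _ mC) iC.
have iDD : integrable_mx mu (fun w => (D0 w)^T *m D0 w).
  exact: integrable_gram (m0 _ _ _ mD) iD.
have iBB : integrable_mx mu (fun w => B0 w *m (B0 w)^T).
  apply: integrable_mulmx => //; [exact: m0|exact/measurable_mx_tr/m0|].
  exact: square_integrable_mx_tr.
have iAA : integrable_mx mu (fun w => (mxvec (A0 w))^T *m mxvec (A0 w)).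
  apply: integrable_gram => i j; rewrite (ord1 i); case/mxvec_indexP: j => k l.
    by under eq_fun do rewrite mxvecE; exact: m0.
  by under eq_fun do rewrite mxvecE; exact: iA.
have iAPA : integrable_mx mu (fun w => (A0 w)^T *m P *m A0 w).
  move=> i j; under eq_fun do rewrite -sandwich_row.
  exact: integrable_scalar iAA.
(* The first inequalities of the two conditions concern the same matrix, so its symmetry is carried
   over too. *)
have -> : expectation_mx mu (fun w => P - (A0 w)^T *m P *m A0 w - (C0 w)^T *m C0 w)
    = P - At^T *m (P *t (1%:M : 'M[R]_nbar)) *m At
      - expectation_mx mu (fun w => (C0 w)^T *m C0 w).
  have iP := integrable_mx_cst mu P.
  rewrite !expectation_mxB//; last exact: integrable_mxB.
  rewrite expectation_mx_cst; congr (_ - _ - _); apply/matrixP => i j.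
  rewrite -sandwich_gram hAbar mxE; under eq_fun do rewrite -sandwich_row.
  by rewrite (expectation_scalar (sandwich P i j) iAA).
have trP w : \tr ((D0 w)^T *m D0 w + (B0 w)^T *m P *m B0 w) =
    \tr ((D0 w)^T *m D0 w) + \tr (B0 w *m (B0 w)^T *m P).
  by rewrite mxtraceD -(mulmxA (B0 w)) (mxtrace_mulC (B0 w)).
(* The functional sending [G] to the trace of [G *m P], to be evaluated at [B0 w *m (B0 w)^T]. *)
pose trmul : {scalar 'M[R]_n} := (@mxtrace R n \o mulmxr P).
have -> : ('E_mu[fun w => \tr ((D0 w)^T *m D0 w + (B0 w)^T *m P *m B0 w)] =
    (\tr (expectation_mx mu (fun w => (D0 w)^T *m D0 w)) +
     \tr (expectation_mx mu (fun w => B0 w *m (B0 w)^T) *m P))%:E)%E.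
  (* Each trace is turned back into an expectation, so that the two integrals merge into one and
     [trP] compares the integrands. *)
  rewrite EFinD -[X in (X + _)%E](expectation_scalar (@mxtrace R pw) iDD).
  rewrite -[X in (_ + X)%E](expectation_scalar trmul iBB).
  rewrite unlock -integralD//; last 2 first.
  - exact: integrable_scalar (@mxtrace R pw) _ iDD.
  - exact: integrable_scalar trmul _ iBB.
  by apply: eq_integral => w _; rewrite trP.
(* The two conditions now differ only in stating the last inequality in the extended reals or in
   [R]. *)
by rewrite lte_fin.
Qed.
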